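(* Let $G$ be a bipartite graph with fixed parts $A$ and $B$ which is proximinal for a semimetric space $(X,d)$ with $X=A\cup B$, and let $G=G'$ hold. Then the following conditions are equivalent: (i) $G$ is path-proximinal for $A$ and $B$ with respect to the semimetric $d$. (ii) The inequality $d(x,y)>\operatorname{dist}(A,B)$ holds whenever $x\neq y$ and either $x,y\in A$ or $x,y\in B$.
   Context: Graphs are simple (no loops, no multiple edges), have a nonempty vertex set $V(G)$ and edge set $E(G)$, and may be infinite. For a graph $G$ with at least one edge, $G'$ is the subgraph of $G$ whose vertices are the non-isolated vertices of $G$ and for which $E(G')=E(G)$; thus $G=G'$ means that $G$ has no isolated vertices. A graph is bipartite with parts $A$ and $B$ if $A,B$ are nonempty, disjoint, $V(G)=A\cup B$, and no edge has both ends in the same part. A semimetric on a nonempty set $X$ is a function $d\colon X\times X\to[0,\infty)$ with $d(x,y)=d(y,x)$ and $d(x,y)=0\Leftrightarrow x=y$ for all $x,y\in X$. A nonempty subset $A$ of $(X,d)$ is proximinal if for every $x\in X$ there is $a_0\in A$ with $d(x,a_0)=\inf\{d(x,a)\colon a\in A\}$. For nonempty $A,B\subseteq X$, $\operatorname{dist}(A,B):=\inf\{d(a,b)\colon a\in A,\ b\in B\}$. A bipartite graph $G$ with fixed parts $A$ and $B$ is proximinal for a semimetric space $(X,d)$ if $A$ and $B$ are disjoint proximinal subsets of $X$ and, for all $a\in A$, $b\in B$, $\{a,b\}\in E(G)\Leftrightarrow d(a,b)=\operatorname{dist}(A,B)$. A path is a finite graph $P$ whose (distinct) vertices can be numbered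 $u_0,\dots,u_k$, $k\ge 1$, so that $E(P)=\{\{u_0,u_1\},\dots,\{u_{k-1},u_k\}\}$. For nonempty disjoint sets $A,B$, a path $P$ is a be-path of $A$ and $B$ if $V(P)\subseteq A\cup B$ and exactly one edge of $P$ meets both $A$ and $B$. A graph $G$ with $A,B\subseteq V(G)$ is a path-bipartite graph of $A$ and $B$ if $G$ is the union (of vertex sets and of edge sets) of a nonempty set of be-paths of $A$ and $B$. Such a $G$, with $X=A\cup B=V(G)$, is path-proximinal for $A$ and $B$ with respect to $d$ if $A$ and $B$ are proximinal subsets of $(X,d)$ and, for all distinct $x,y\in X$, $\{x,y\}\in E(G)\Leftrightarrow d(x,y)\le\operatorname{dist}(A,B)$. *)

(* Defs.v *)
From HB Require Import structures.
From mathcomp Require Import all_boot all_order all_algebra.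
From mathcomp Require Import boolp classical_sets reals.

Set Implicit Arguments.
Unset Strict Implicit.
Unset Printing Implicit Defensive.

Import Order.TTheory GRing.Theory Num.Theory.

Local Open Scope classical_set_scope.
Local Open Scope ring_scope.

(* Simple, possibly infinite graphs whose vertices lie in an ambient type [T];
   an edge is an unordered pair, i.e. a set [set x; y] with x <> y. *)
Record graph (T : Type) := Graph {
  vertices : set T;
  edges : set (set T);
  vertices_neq0 : vertices !=set0;
  edges_pair : forall e, edges e ->
    exists x y, [/\ vertices x, vertices y, x <> y & e = [set x; y]]
}.

Lemma graph_ext (T : Type) (G H : graph T) :
  vertices G = vertices H -> edges G = edges H -> G = H.
Proof.
case: G H => [V E V0 EP] [W F W0 FP] /= eVW eEF; subst W F.
by rewrite (Prop_irrelevance V0 W0) (Prop_irrelevance EP FP).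
Qed.

Definition isolated (T : Type) (G : graph T) (x : T) : Prop :=
  vertices G x /\ forall e, edges G e -> ~ e x.

Section NonIsolatedPart.
Variables (T : Type) (G : graph T) (G_edge : edges G !=set0).

Let V' : set T := [set x | vertices G x /\ ~ isolated G x].

Fact non_isolated_edges_pair (e : set T) : edges G e ->
  exists x y, [/\ V' x, V' y, x <> y & e = [set x; y]].
Proof.
move=> Ee; have [x [y [Vx Vy xy eE]]] := edges_pair Ee.
exists x, y; split=> //; split=> // -[_ /(_ _ Ee)]; apply; rewrite eE.
  by left.
by right.
Qed.

Fact non_isolated_vertices_neq0 : V' !=set0.
Proof.
have [e /non_isolated_edges_pair [x [_ [V'x _ _ _]]]] := G_edge.
by exists x.
Qed.

(* The graph G', defined only when G has at least one edge. *)
Definition non_isolated_part : graph T :=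
  Graph non_isolated_vertices_neq0 non_isolated_edges_pair.

End NonIsolatedPart.

Definition bipartite (T : Type) (G : graph T) (A B : set T) : Prop :=
  [/\ A !=set0, B !=set0, A `&` B = set0, vertices G = A `|` B &
      forall e, edges G e -> ~ (e `<=` A) /\ ~ (e `<=` B)].

Definition is_path (T : Type) (P : graph T) : Prop :=
  exists (k : nat) (u : nat -> T),
    [/\ (1 <= k)%N,
        forall i j, (i <= k)%N -> (j <= k)%N -> u i = u j -> i = j,
        vertices P = [set u i | i in [set i | (i <= k)%N]] &
        edges P = [set [set u i; u i.+1] | i in [set i | (i < k)%N]]].

Definition be_path (T : Type) (A B : set T) (P : graph T) : Prop :=
  [/\ is_path P, vertices P `<=` A `|` B &
      exists! e, [/\ edges P e, e `&` A !=set0 & e `&` B !=set0]].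

Definition path_bipartite (T : Type) (G : graph T) (A B : set T) : Prop :=
  [/\ A !=set0 /\ B !=set0, A `&` B = set0,
      A `<=` vertices G /\ B `<=` vertices G &
      exists F : set (graph T),
        [/\ F !=set0, F `<=` be_path A B,
            vertices G = \bigcup_(P in F) vertices P &
            edges G = \bigcup_(P in F) edges P]].

Definition semimetric (R : realType) (X : Type) (d : X -> X -> R) : Prop :=
  [/\ forall x y, 0 <= d x y,
      forall x y, d x y = d y x &
      forall x y, d x y = 0 <-> x = y].

Definition proximinal (R : realType) (X : Type) (d : X -> X -> R)
    (A : set X) : Prop :=
  A !=set0 /\
  forall x, exists2 a0, A a0 & d x a0 = inf [set d x a | a in A].

Definition dist (R : realType) (X : Type) (d : X -> X -> R)
    (A B : set X) : R :=
  inf [set d a b | a in A & b in B].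

Definition proximinal_graph (R : realType) (X : Type) (d : X -> X -> R)
    (G : graph X) (A B : set X) : Prop :=
  [/\ A `&` B = set0, proximinal d A, proximinal d B &
      forall a b, A a -> B b ->
        (edges G [set a; b] <-> d a b = dist d A B)].

(* The underlying set of the space is the whole type [X], whence the
   condition [vertices G = setT]. *)
Definition path_proximinal (R : realType) (X : Type) (d : X -> X -> R)
    (G : graph X) (A B : set X) : Prop :=
  [/\ path_bipartite G A B, A `|` B = setT /\ vertices G = setT,
      proximinal d A, proximinal d B &
      forall x y, x <> y ->
        (edges G [set x; y] <-> d x y <= dist d A B)].

(* Main.v *)
Require Import Defs.
From HB Require Import structures.
From mathcomp Require Import all_boot all_order all_algebra.
From mathcomp Require Import boolp classical_sets reals.

Set Implicit Arguments.
Unset Strict Implicit.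
Unset Printing Implicit Defensive.

Import Order.TTheory GRing.Theory Num.Theory.

Local Open Scope classical_set_scope.
Local Open Scope ring_scope.

(** Path-proximinality extends the edge criterion from cross pairs to all pairs, so only pairs
    inside one part matter. Such a pair is never an edge of a bipartite graph, hence the criterion
    for it says exactly that its distance exceeds [dist d A B], which is (ii). For cross pairs, [=]
    and [<=] agree because [dist d A B] is a lower bound ([dist_le]). The path-bipartite structure
    comes from [G = G']: the edges, viewed as one-edge be-paths, cover [G]
    ([bipartite_path_bipartite]). *)

Lemma bipartite_edgeP (T : Type) (G : graph T) (A B e : set T) :
  bipartite G A B -> edges G e ->
  exists a b, [/\ A a, B b & e = [set a; b]].
Proof.
case=> _ _ _ VG nAB Ee; have [x [y [Vx Vy _ eE]]] := edges_pair Ee.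
have [neA neB] := nAB _ Ee.
move: Vx Vy; rewrite VG => -[Ax|Bx] -[Ay|By].
- by exfalso; apply: neA; rewrite eE => z [->|->].
- by exists x, y.
- by exists y, x; rewrite setUC.
- by exfalso; apply: neB; rewrite eE => z [->|->].
Qed.

Lemma dist_le (R : realType) (X : Type) (d : X -> X -> R) (A B : set X) a b :
  semimetric d -> A a -> B b -> dist d A B <= d a b.
Proof.
(* A real infimum lies below the members only if the set is bounded below; nonnegativity of [d]
   gives the bound 0. *)
move=> [d_ge0 _ _] Aa Bb; apply: ge_inf; last by exists a => //; exists b.
by exists 0 => _ [x _ [y _ <-]].
Qed.

Section EdgeGraph.
Variables (T : Type) (x y : T) (xy : x <> y).

Fact edge_graph_neq0 : [set x; y] !=set0.
Proof. by exists x; left. Qed.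

Fact edge_graph_pair (e : set T) : [set [set x; y]] e ->
  exists u v, [/\ [set x; y] u, [set x; y] v, u <> v & e = [set u; v]].
Proof. by move=> ->; exists x, y; split=> //; [left|right]. Qed.

Definition edge_graph : graph T := Graph edge_graph_neq0 edge_graph_pair.

Lemma edge_graph_path : is_path edge_graph.
Proof.
(* With [k = 1] only the indices 0 and 1 count, so the constant tail of the numbering does not break
   injectivity. *)
exists 1%N, (fun i => if i is 0 then x else y); split=> //=.
- by move=> [|[|i]] [|[|j]] //= _ _ E; case: xy.
- apply/seteqP; split=> [z [->|->]|z [[|[|i]] //= _ <-]]; [|..|by left|by right].
  + by exists 0.
  + by exists 1.
- by apply/seteqP; split=> [e ->|e [[|i] //= _ <-] //]; exists 0.
Qed.

Lemma edge_graph_be_path (A B : set T) : A x -> B y -> be_path A B edge_graph.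
Proof.
move=> Ax By; split=> [|z [->|->]|]; [exact: edge_graph_path|by left|by right|].
exists [set x; y]; split=> [|e [-> //]].
by split=> //; [exists x; split=> //; left|exists y; split=> //; right].
Qed.

End EdgeGraph.

(* Each edge of G is by itself a be-path, and these cover V(G) since no vertex
   is isolated. *)
Lemma bipartite_path_bipartite (T : Type) (G : graph T) (A B : set T)
    (G_edge : edges G !=set0) :
  bipartite G A B -> G = non_isolated_part G_edge -> path_bipartite G A B.
Proof.
move=> bG GE; have [A0 B0 AB0 VG _] := bG.
have edge_P e : edges G e -> exists P, [/\ be_path A B P, vertices P = e &
    edges P = [set e]].
  move=> /(bipartite_edgeP bG)[a [b [Aa Bb ->]]].
  have ab : a <> b.
    by move=> ab; suff: (A `&` B) b; [rewrite AB0|split=> //; rewrite -ab].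
  by exists (edge_graph ab); split=> //; exact: edge_graph_be_path.
split=> //; first by rewrite VG; split; [exact: subsetUl|exact: subsetUr].
(* Describing the one-edge paths by their vertex and edge sets avoids indexing the family by proofs
   of [x <> y]. *)
exists [set P | be_path A B P /\ exists e, [/\ edges G e, vertices P = e &
  edges P = [set e]]]; split.
- have [e Ee] := G_edge; have [P [bP VP EP]] := edge_P e Ee.
  by exists P; split=> //; exists e.
- by move=> P [].
- apply/seteqP; split=> [x Vx|x [P [_ [e [Ee -> _]]] ex]].
    have [_ nix] : vertices (non_isolated_part G_edge) x by rewrite -GE.
    (* Being non-isolated is a negation, so an edge through [x] is obtained classically: if no path
       of the family met [x], then [x] would be isolated. *)
    apply: contrapT => nx; apply: nix; split=> // e Ee ex; apply: nx.
    have [P [bP VP EP]] := edge_P e Ee.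
    by exists P; [split=> //; exists e|rewrite VP].
  by have [u [v [Vu Vv _ eE]]] := edges_pair Ee; move: ex; rewrite eE => -[->|->].
- apply/seteqP; split=> [e Ee|e [P [_ [f [Ef _ ->]]] -> //]].
  have [P [bP VP EP]] := edge_P e Ee.
  by exists P; [split=> //; exists e|rewrite EP].
Qed.

Theorem proposition3p9 (R : realType) (X : Type) (d : X -> X -> R)
    (G : graph X) (A B : set X)
    (d_semimetric : semimetric d)
    (X_AB : A `|` B = setT)
    (G_bipartite : bipartite G A B)
    (G_proximinal : proximinal_graph d G A B)
    (G_edge : edges G !=set0)
    (G_reduced : G = non_isolated_part G_edge) :
  path_proximinal d G A B <->
  (forall x y : X, x <> y -> (A x /\ A y) \/ (B x /\ B y) ->
     dist d A B < d x y).
Proof.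
have [_ _ _ VG noE] := G_bipartite.
have [_ pA pB EG] := G_proximinal; have [_ dC _] := d_semimetric.
split=> [[_ _ _ _ ppE] x y xy sameAB|far].
  rewrite ltNge; apply/negP => /(ppE x y xy).2/noE[neA neB].
  by case: sameAB => -[hx hy]; [apply: neA|apply: neB] => z [->|->].
split=> //; [exact: bipartite_path_bipartite G_reduced|by rewrite VG|].
(* Across the parts, [d a b] is never below [dist d A B], so the inequality forces the equality of
   [G_proximinal]. *)
have cross a b : A a -> B b -> edges G [set a; b] <-> d a b <= dist d A B.
  move=> Aa Bb; rewrite (EG _ _ Aa Bb); split=> [->//|dab].
  by apply/eqP; rewrite eq_le dab dist_le.
(* Inside a part both sides are false: the left by bipartiteness, the right by [far]. *)
have same x y : x <> y -> (A x /\ A y) \/ (B x /\ B y) ->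
    edges G [set x; y] <-> d x y <= dist d A B.
  move=> xy sameAB; split=> [/noE[neA neB]|]; last by rewrite leNgt far.
  by case: sameAB => -[hx hy]; [case: neA|case: neB] => z [->|->].
have AorB z : A z \/ B z by have: (A `|` B) z by rewrite X_AB.
move=> x y xy; case: (AorB x) (AorB y) => [Ax|Bx] [Ay|By].
- by apply: same => //; left.
- exact: cross.
- by rewrite setUC dC; exact: cross.
- by apply: same => //; right.
Qed.
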